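(* For every constant $0<\varepsilon\le 1/100$ and every sufficiently large integer $n$ the following holds. Suppose that (i) $0<p=p(n)<1$; (ii) $G$ is a graph with $|V(G)|=n$; (iii) $\delta(G)\ge \frac{10\ln n}{\varepsilon p}$; and (iv) $\mathcal P$ is a monotone increasing graph property which is $(G,p,\varepsilon)$-resilient. Then Maker has a winning strategy in the $(1:\lfloor \frac{\varepsilon}{20p}\rfloor)$ Maker-Breaker game $\mathcal P(G)$.
   Context: In an $(a:b)$ Maker-Breaker game on a finite board $X$ with a family $\mathcal F\subseteq 2^X$ of winning sets, Maker and Breaker alternately claim previously unclaimed elements of $X$, Maker claiming $a$ and Breaker $b$ elements per turn; Maker wins if he claims all elements of some winning set, otherwise Breaker wins. For a graph $G$ and a monotone increasing graph property $\mathcal P$, the game $\mathcal P(G)$ is played on the board $E(G)$ and its winning sets are the edge sets of the edge-minimal subgraphs of $G$ having $\mathcal P$ (i.e. Maker wins iff his graph has $\mathcal P$). For a graph $G$ and $0<p<1$, $\mathcal G(G,p)$ denotes the random subgraph of $G$ obtained by keeping each edge independently with probability $p$. The local resilience of a graph $G'$ with respect to a monotone increasing property $\mathcal P$ is the minimum $0\le r\le 1$ such that by deleting at each vertex $v$ at most $r\cdot d_{G'}(v)$ edges one can obtain a graph not having $\mathcal P$. For a sequence of graphs $G=G_n$ ($G_n$ on $n$ vertices), $p=p(n)$ and $0\le r\le 1$, $\mathcal P$ is called $(G,p,r)$-resilient if asymptotically almost surely (with probability tending to $1$ as $n\to\infty$) the local resilience of $G'\sim\mathcal G(G,p)$ with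 respect to $\mathcal P$ is at least $r$. *)

(* Defs.v *)
From HB Require Import structures.
From mathcomp Require Import all_boot all_order all_algebra.
From mathcomp Require Import all_classical all_reals all_analysis.

Set Implicit Arguments.
Unset Strict Implicit.
Unset Printing Implicit Defensive.

Import Order.TTheory GRing.Theory Num.Theory.
Import numFieldNormedType.Exports.

Local Open Scope ring_scope.

Section MakerBreaker.
Variables (T : finType) (X : {set T}) (F : set {set T}) (a b : nat).
Variable maker_first : bool.

(* A history lists the sets claimed in the successive turns, oldest first. *)
Definition history := seq {set T}.

Definition maker_turn (i : nat) : bool := odd i (+) maker_first.

Definition unclaimed (h : history) : {set T} := X :\: \bigcup_(A <- h) A.

(* When fewer elements are left than the bias, the player takes all of them. *)
Definition legal_move (h : history) (A : {set T}) : bool :=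
  (A \subset unclaimed h) &&
  (#|A| == minn (if maker_turn (size h) then a else b) #|unclaimed h|).

Definition strategy := history -> {set T}.

Definition maker_strategy (s : strategy) : Prop :=
  forall h, maker_turn (size h) -> legal_move h (s h).

Definition breaker_strategy (s : strategy) : Prop :=
  forall h, ~~ maker_turn (size h) -> legal_move h (s h).

Fixpoint run (s t : strategy) (k : nat) : history :=
  if k is k'.+1 then
    let h := run s t k' in
    rcons h (if maker_turn (size h) then s h else t h)
  else [::].

Definition maker_claimed (h : history) : {set T} :=
  \bigcup_(i < size h | maker_turn i) nth finset.set0 h i.

Definition maker_has_winning_strategy : Prop :=
  exists2 s, maker_strategy s &
    forall t, breaker_strategy t ->
      exists k, exists2 W, F W & W \subset maker_claimed (run s t k).

End MakerBreaker.

Record sgraph (V : finType) := SGraph {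
  edges : {set {set V}};
  _ : [forall e in edges, #|e| == 2%N] }.

HB.instance Definition _ (V : finType) := [isSub for @edges V].
HB.instance Definition _ (V : finType) := [Finite of sgraph V by <:].

Section Graphs.
Variable V : finType.
Implicit Types G H : sgraph V.

(* Subgraphs are spanning. *)
Definition subgraph H G : bool := edges H \subset edges G.

Definition degree_in (E : {set {set V}}) (v : V) : nat :=
  #|[set e in E | v \in e]%SET|.

Definition degree G (v : V) : nat := degree_in (edges G) v.

(* Every degree is less than #|V|, so for nonempty V this is the minimum. *)
Definition min_degree G : nat := \big[minn/#|V|]_(v : V) degree G v.

End Graphs.

Definition graph_prop := forall V : finType, sgraph V -> Prop.

Definition isomorphic (V W : finType) (G : sgraph V) (H : sgraph W) : Prop :=
  exists2 f : V -> W, bijective f &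
    edges H = [set f @: e | e : {set V} in edges G]%SET.

Definition iso_closed (P : graph_prop) : Prop :=
  forall (V W : finType) (G : sgraph V) (H : sgraph W),
    isomorphic G H -> P V G -> P W H.

Definition edge_monotone (P : graph_prop) : Prop :=
  forall (V : finType) (G H : sgraph V), subgraph G H -> P V G -> P V H.

Definition monotone_increasing_property (P : graph_prop) : Prop :=
  iso_closed P /\ edge_monotone P.

Definition winning_sets (P : graph_prop) (V : finType) (G : sgraph V)
    (W : {set {set V}}) : Prop :=
  exists H : sgraph V,
    [/\ subgraph H G, P V H,
        (forall H' : sgraph V, subgraph H' H -> P V H' -> H' = H)
      & W = edges H].

Section Resilience.
Variable R : realType.

(* Probability that the random subgraph of G keeping each edge independently *)
(* with probability p belongs to Q. *)
Definition random_subgraph_prob (V : finType) (G : sgraph V) (p : R)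
    (Q : sgraph V -> Prop) : R :=
  \sum_(H : sgraph V | subgraph H G && `[< Q H >])
    \prod_(e in edges G) (if e \in edges H then p else 1 - p).

Definition destroyable (P : graph_prop) (V : finType) (G : sgraph V) (r : R)
    : Prop :=
  exists H : sgraph V,
    [/\ subgraph H G,
        (forall v, (degree_in (edges G :\: edges H) v)%:R
                     <= r * (degree G v)%:R)
      & ~ P V H].

(* The infimum is a minimum, since only finitely many H are involved, unless *)
(* even the edgeless graph on V has P; in that case it is +oo. *)
Definition local_resilience (P : graph_prop) (V : finType) (G : sgraph V)
    : \bar R :=
  ereal_inf [set r%:E | r in
    [set r : R | 0 <= r <= 1 /\ destroyable P G r]]%classic.

Definition resilient (P : graph_prop) (V : nat -> finType)
    (G : forall n, sgraph (V n)) (p : nat -> R) (r : R) : Prop :=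
  ((fun n => random_subgraph_prob (G n) (p n)
     (fun G' => (r%:E <= local_resilience P G')%E)) @ \oo --> (1 : R))%classic.

End Resilience.

(* Main.v *)
(** Maker simulates the random graph. In each turn he picks the vertex v with
    unexposed edges that Breaker has attacked most, relative to the number of
    turns already spent on v, and tosses the p-coins of the unexposed edges at
    v until one succeeds; he claims that edge if it is free. An edge of the
    simulated random graph S is lost only if Breaker owned it when its coin was
    tossed. The box-game potential argument keeps Breaker's degree at each
    vertex with unexposed edges at most 2b (ln n + 1 + deg_S v), so, since
    deg_S v < 8/5 p deg v, the edges at v whose coin is tossed too late form a
    proportion below eps/6, of which only a fraction p is successful: S loses
    less than eps deg_S v edges at each v, and resilience gives P.

    The coins are derandomised by conditional expectations: Maker chooses each
    outcome so that P(S resilient | exposed coins) minus a sum of exponential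
    tail bounds does not decrease. This quantity starts positive, so at the end
    S is resilient and no tail event has occurred. *)

Require Import Defs.
From HB Require Import structures.
From mathcomp Require Import all_boot all_order all_algebra.
From mathcomp Require Import all_classical all_reals all_analysis.
From mathcomp Require Import ring lra fintype finset.

Set Implicit Arguments.
Unset Strict Implicit.
Unset Printing Implicit Defensive.

Import Order.TTheory GRing.Theory Num.Theory.
Import numFieldNormedType.Exports.

Local Open Scope ring_scope.

(** * Strategies obtained from invariants of histories *)

Section Games.
Variable T : finType.
Implicit Types (X A : {set T}) (h : history T).

Lemma exists_subset_card X k :
  (k <= #|X|)%N -> exists2 A : {set T}, A \subset X & #|A| = k.
Proof.
move=> /card_geqP[s [us <- sX]]; exists [set:: s]%SET.
  by apply/subsetP => x; rewrite inE => /sX.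
by rewrite cardsE; apply/card_uniqP.
Qed.

Lemma exists_legal_move X a b mf h : exists A, legal_move X a b mf h A.
Proof.
have [A sA cA] := exists_subset_card
  (geq_minr (if maker_turn mf (size h) then a else b) #|unclaimed X h|).
by exists A; rewrite /legal_move sA cA eqxx.
Qed.

Lemma claimed_rcons mf h A :
  maker_claimed mf (rcons h A) =
  if maker_turn mf (size h) then maker_claimed mf h :|: A
  else maker_claimed mf h.
Proof.
rewrite /maker_claimed size_rcons [LHS]big_mkcond big_ord_recr /=.
rewrite [in RHS]big_mkcond /= nth_rcons ltnn eqxx.
under eq_bigr => i _ do rewrite nth_rcons ltn_ord.
by case: ifP => _ //; rewrite setU0.
Qed.

Lemma maker_turnN mf i : maker_turn (~~ mf) i = ~~ maker_turn mf i.
Proof. by rewrite /maker_turn addbN. Qed.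

Lemma bigcup_claimed mf h :
  \bigcup_(A <- h) A = maker_claimed mf h :|: maker_claimed (~~ mf) h.
Proof.
elim/last_ind: h => [|h A IH].
  by rewrite big_nil /maker_claimed !big_ord0 setU0.
rewrite big_rcons /= IH !claimed_rcons maker_turnN.
by case: maker_turn => /=; [rewrite setUAC | rewrite -setUA].
Qed.

(** Replies preserving [Inv] are assembled into a strategy by choice; a history off the invariant
    gets an arbitrary legal move, since a strategy must be legal there too. *)
Lemma maker_wins_by_invariant X (F : {set T} -> Prop) a b mf
    (Inv : history T -> Prop) K :
  Inv [::] ->
  (forall h, Inv h -> maker_turn mf (size h) ->
     exists2 A, legal_move X a b mf h A & Inv (rcons h A)) ->
  (forall h A, Inv h -> ~~ maker_turn mf (size h) ->
     legal_move X a b mf h A -> Inv (rcons h A)) ->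
  (forall h, Inv h -> (K <= size h)%N ->
     exists2 W, F W & W \subset maker_claimed mf h) ->
  maker_has_winning_strategy X F a b mf.
Proof.
move=> Inv0 InvM InvB InvK.
have /choice[s sP] : forall h, exists A, legal_move X a b mf h A /\
    (Inv h -> maker_turn mf (size h) -> Inv (rcons h A)).
  move=> h; have [[Ih mh]|nI] := pselect (Inv h /\ maker_turn mf (size h)).
    by have [A lA IA] := InvM h Ih mh; exists A.
  by have [A lA] := exists_legal_move X a b mf h; exists A; split=> // Ih mh;
    case: nI.
exists s => [h _|t tP]; first by case: (sP h).
have size_run k : size (run mf s t k) = k.
  by elim: k => //= k IH; rewrite size_rcons IH.
have InvR k : Inv (run mf s t k).
  elim: k => //= k IH; case: ifPn => mk; first by apply: (sP _).2.
  by apply: InvB => //; apply: tP.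
have [|W FW sW] := InvK _ (InvR K); first by rewrite size_run.
by exists K, W.
Qed.

End Games.

(** * Degrees in edge sets, and minimal subgraphs with a property *)

Section Degrees.
Variable V : finType.
Implicit Types (A B : {set {set V}}) (e : {set V}) (v : V).

Lemma degree_in0 v : degree_in (set0 : {set {set V}}) v = 0%N.
Proof.
by apply/eqP; rewrite cards_eq0; apply/eqP/setP => e; rewrite !inE.
Qed.

Lemma degree_inS A B v : A \subset B -> (degree_in A v <= degree_in B v)%N.
Proof.
move=> sAB; apply/subset_leq_card/subsetP => e; rewrite !inE.
by case/andP => /(subsetP sAB) -> ->.
Qed.

Lemma degree_inU A B v :
  (degree_in (A :|: B) v <= degree_in A v + degree_in B v)%N.
Proof.
rewrite /degree_in; apply: leq_trans (leq_card_setU _ _).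
by apply/subset_leq_card/subsetP => e; rewrite !inE andb_orl.
Qed.

Lemma degree_inU1 A e v :
  e \notin A -> degree_in (e |: A) v = ((v \in e) + degree_in A v)%N.
Proof.
move=> eA; rewrite /degree_in.
have [ve|nve] /= := boolP (v \in e).
  have -> : [set f in e |: A | v \in f]%SET = e |: [set f in A | v \in f]%SET.
    apply/setP => f; rewrite !inE andb_orl.
    by case: eqP => //= ->; rewrite ve.
  by rewrite cardsU1 inE (negPf eA).
congr #|pred_of_set _|; apply/setP => f; rewrite !inE andb_orl.
by case: eqP => //= ->; rewrite (negPf nve) !andbF.
Qed.

Lemma sum_degree_in A : \sum_(v : V) degree_in A v = \sum_(e in A) #|e| :> nat.
Proof.
under eq_bigr => v _ do rewrite /degree_in -sum1_card.
under [RHS]eq_bigr => e _ do rewrite -sum1_card.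
rewrite (exchange_big_dep (mem A)) /=; last first.
  by move=> v e _; rewrite inE => /andP[].
by apply: eq_bigr => e eA; apply: eq_bigl => v; rewrite inE eA.
Qed.

Lemma sgraph_card_edge (G : sgraph V) e : e \in edges G -> #|e| = 2%N.
Proof. by case: G => E /= /forall_inP/(_ e) + eE => /(_ eE)/eqP. Qed.

Lemma subset_edgesP (G : sgraph V) A :
  A \subset edges G -> [forall e in A, #|e| == 2%N].
Proof.
move=> /subsetP sA; apply/forall_inP => e /sA eG.
by rewrite (sgraph_card_edge eG).
Qed.

Lemma min_degree_le (G : sgraph V) v : (min_degree G <= degree G v)%N.
Proof.
rewrite /min_degree; elim: (index_enum V) (mem_index_enum v) => // u s IH.
rewrite inE big_cons => /predU1P[<-|/IH]; first exact: geq_minl.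
exact: leq_trans (geq_minr _ _).
Qed.

(** Among the subgraphs of [H] with [P], one with fewest edges is edge-minimal. *)
Lemma winning_sets_of_subgraph (P : graph_prop) (G H : sgraph V) :
  subgraph H G -> P V H -> exists2 W, winning_sets P G W & W \subset edges H.
Proof.
move=> sHG PH.
pose Q (K : sgraph V) := subgraph K H && `[< P V K >].
have HP : Q H by rewrite /Q /subgraph subxx; apply/asboolP.
case: (arg_minnP (fun K : sgraph V => #|edges K|) HP).
move=> K /andP[sKH /asboolP PK] minK; exists (edges K) => //.
exists K; split => //; first exact: subset_trans sHG.
move=> H' sH'K PH'; apply: val_inj; apply/eqP; rewrite eqEcard.
apply/andP; split; first exact: sH'K.
apply: minK; apply/andP; split; last exact/asboolP.
exact: subset_trans sKH.
Qed.

End Degrees.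

(** * Conditional probabilities and exponential moments as edges are exposed *)

Section Exposure.
Variables (R : realType) (V : finType) (p : R).
Hypothesis p01 : 0 < p < 1.
Implicit Types (X S Y : {set {set V}}) (e : {set V}) (v : V).

(* The probability that the random subgraph of G satisfies Q, given that its *)
(* edges inside X are exactly those of S. *)
Definition cond_prob (G : sgraph V) (Q : sgraph V -> Prop) X S : R :=
  \sum_(H : sgraph V | [&& subgraph H G, `[< Q H >] & edges H :&: X == S])
    \prod_(e in edges G :\: X) (if e \in edges H then p else 1 - p).

Lemma cond_prob0 G Q : cond_prob G Q set0 set0 = random_subgraph_prob G p Q.
Proof.
rewrite /cond_prob setD0; apply: eq_bigl => H.
by rewrite setI0 eqxx andbT.
Qed.

(** Total probability over the coin of [e]: graphs with [e] carry the factor [p], graphs without it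
    [1 - p]. *)
Lemma cond_prob_expose G Q X S e :
  e \in edges G :\: X -> S \subset X ->
  cond_prob G Q X S =
  p * cond_prob G Q (e |: X) (e |: S) + (1 - p) * cond_prob G Q (e |: X) S.
Proof.
move=> eGX sSX; have [eG eX] : e \in edges G /\ e \notin X.
  by move: eGX; rewrite inE => /andP[].
have eS : e \notin S by apply: contra eX; apply: (subsetP sSX).
have DX : (edges G :\: X) :\ e = edges G :\: (e |: X).
  by apply/setP => f; rewrite !inE negb_or; case: eqP; case: (f \in X).
rewrite /cond_prob (bigID (fun H : sgraph V => e \in edges H)) /= !mulr_sumr.
congr (_ + _).
  apply: eq_big => [H|H /andP[_ eH]].
    rewrite -!andbA; congr [&& _, _ & _]; rewrite /=;
      apply/andP/eqP => [[/eqP <- eH]|HX].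
      apply/setP => f; rewrite !inE.
      by case: eqP => [->|_] /=; rewrite ?eH ?orbT ?andbT.
    have eH : e \in edges H.
      by move/setP/(_ e): HX; rewrite !inE eqxx /= andbT.
    split => //; apply/eqP/setP => f; move/setP/(_ f): HX; rewrite !inE.
    by case: eqP => [->|_] //=; rewrite (negPf eX) (negPf eS) andbF.
  by rewrite (big_setD1 e) //= eH DX.
apply: eq_big => [H|H /andP[_ eH]].
  rewrite -!andbA; congr [&& _, _ & _]; rewrite /=;
      apply/andP/eqP => [[/eqP <- eH]|HX].
    apply/setP => f; rewrite !inE.
    by case: eqP => [->|_] /=; rewrite ?(negPf eH).
  have eH : e \notin edges H.
    by move/setP/(_ e): HX; rewrite !inE eqxx /= andbT (negPf eS) => ->.
  split => //; apply/eqP/setP => f; move/setP/(_ f): HX; rewrite !inE.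
  by case: eqP => [->|_] //=; rewrite (negPf eX) (negPf eS) andbF.
by rewrite (big_setD1 e) //= (negPf eH) DX.
Qed.

(** Nothing is left to chance: at most one graph is summed over and its product is empty, so the
    value is 0 or 1. *)
Lemma cond_prob_full G Q S :
  cond_prob G Q (edges G) S <= 1 /\
  (0 < cond_prob G Q (edges G) S -> exists2 H, edges H = S & Q H).
Proof.
rewrite /cond_prob setDv.
under eq_bigr => H _ do rewrite big_set0.
have [[H [sHG QH HS]]|nH] := pselect (exists H : sgraph V,
    [/\ subgraph H G, Q H & edges H :&: edges G = S]).
  rewrite (big_pred1 H) => [|K].
    split=> // _; exists H => //; rewrite -HS; apply/esym/setIidPl; exact: sHG.
  apply/and3P/eqP => [[sKG _ /eqP KS]|->]; last first.
    by split; [|exact/asboolP|exact/eqP].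
  apply: val_inj; move: KS HS; rewrite (setIidPl sKG) (setIidPl sHG).
  by move=> KS HS; exact: etrans KS (esym HS).
rewrite big_pred0 ?ler01 ?ltxx // => K; apply/and3P => -[sK /asboolP QK /eqP KS].
by case: nH; exists K.
Qed.

(** A Chernoff-type exponential moment. A value below 1 forces a negative exponent, which bounds the
    degree in [S] from above or below according to the sign of [lam]; [c] sets the threshold. *)
Definition tail (lam mu c : R) S X v : R :=
  expR (lam * (degree_in S v)%:R - mu * p * (degree_in X v)%:R + c).

(* E[exp (lam * coin)] = 1 + p (exp lam - 1) <= 1 + mu p <= exp (mu p). *)
Lemma tail_expose lam mu c S X e v :
  expR lam <= 1 + mu -> e \notin X -> S \subset X ->
  p * tail lam mu c (e |: S) (e |: X) v +
  (1 - p) * tail lam mu c S (e |: X) v <= tail lam mu c S X v.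
Proof.
move=> lmu eX sSX; have /andP[p0 p1] := p01.
have eS : e \notin S by apply: contra eX; apply: (subsetP sSX).
rewrite /tail !degree_inU1 //; case: (v \in e) => /=; last first.
  by rewrite !add0n -mulrDl addrC subrK mul1r.
rewrite !natrD.
set s := (degree_in S v)%:R; set x := (degree_in X v)%:R.
have -> : lam * (1 + s) - mu * p * (1 + x) + c =
  (lam * s - mu * p * x + c) + (- (mu * p)) + lam by ring.
have -> : lam * s - mu * p * (1 + x) + c =
  (lam * s - mu * p * x + c) + (- (mu * p)) by ring.
rewrite !expRD; set E := expR _ * _ * _; set N := expR (- _).
rewrite (_ : p * (E * N * expR lam) + (1 - p) * (E * N) =
  E * (N * (1 + p * (expR lam - 1)))); last by ring.
rewrite -[leRHS]mulr1 ler_wpM2l ?mulr_ge0 ?expR_ge0 //.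
rewrite /N expRN mulrC ler_pdivrMr ?expR_gt0 // mul1r.
apply: le_trans (expR_ge1Dx _); rewrite lerD2l (mulrC p) ler_wpM2r ?(ltW p0) //.
by rewrite lerBlDl.
Qed.

End Exposure.

(** * The box-game potential *)

Section Danger.
Variables (R : realType) (V : finType).
Implicit Types (A J : {set V}) (D : V -> R).

(** The average of [D] over [J] is at most [q] times the logarithm of [#|V| / #|J|], up to
    [slack / #|J|]. Singletons give the bound wanted in the end; larger [J] carry the induction over
    turns. *)
Definition danger_bound A D (q slack : R) : Prop :=
  forall J, J \subset A ->
    \sum_(v in J) D v <= #|J|%:R * q * (ln #|V|%:R - ln #|J|%:R) + slack.

(** Harmonic increments are dominated by logarithmic ones: ln(1 + x) <= x at x = -1/(j+1). *)
Lemma ln_step (j : nat) : (0 < j)%N ->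
  ln (j%:R : R) <= ln j.+1%:R - j.+1%:R^-1.
Proof.
move=> j0; have J0 : 0 < j.+1%:R :> R by rewrite ltr0n.
have i1 : -1 < - (j.+1%:R^-1 : R).
  by rewrite ltrN2 invf_lt1 // ltr1n.
have -> : j%:R = j.+1%:R * (1 + - j.+1%:R^-1) :> R.
  by rewrite mulrDr mulr1 mulrN divff ?gt_eqF // -natr1 addrK.
rewrite lnM ?posrE ?ltr0n //; last by rewrite -ltrBlDl sub0r.
by rewrite lerD2l le_ln1Dx.
Qed.

Lemma danger_bound_const0 A (q slack : R) : 0 <= q -> 0 <= slack ->
  danger_bound A (fun=> 0) q slack.
Proof.
move=> q0 s0 J _; rewrite big1 // addr_ge0 //.
have [->|J0] := posnP #|J|; first by rewrite !mul0r.
rewrite mulr_ge0 ?mulr_ge0 ?ler0n // subr_ge0 ler_ln ?posrE ?ltr0n //.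
  by rewrite ler_nat max_card.
exact: leq_trans J0 (max_card _).
Qed.

Lemma danger_boundD A D D' (q s a : R) :
  (forall v, D v <= D' v) -> \sum_v (D' v - D v) <= a ->
  danger_bound A D q s -> danger_bound A D' q (s + a).
Proof.
move=> DD' Da bD J /bD bJ.
have -> : \sum_(v in J) D' v =
    \sum_(v in J) D v + \sum_(v in J) (D' v - D v).
  by rewrite -big_split /=; apply: eq_bigr => v _; rewrite addrC subrK.
rewrite addrA lerD //; apply: le_trans Da.
rewrite [leRHS](bigID (mem J)) /= lerDl sumr_ge0 // => v _.
by rewrite subr_ge0.
Qed.

(* If the most dangerous vertex u lies outside J, then the average danger of *)
(* J is at most that of u |: J, and the logarithm absorbs the slack. *)
Lemma danger_bound_greedy A A' D u (q : R) : 0 <= q ->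
  u \in A -> {in A, forall v, D v <= D u} -> A' \subset A ->
  danger_bound A D q q ->
  danger_bound A' (fun v => D v - q * (v == u)%:R) q 0.
Proof.
move=> q0 uA Du sA bD J sJ.
have sJA := subset_trans sJ sA.
rewrite sumrB -mulr_sumr addr0.
have [uJ|nuJ] := boolP (u \in J).
  (* Lowering [u] by [q] pays for the slack exactly. *)
  rewrite [X in _ - q * X](bigD1 u) //= eqxx.
  rewrite [X in true%:R + X]big1 => [|v /andP[_ /negPf->] //].
  by rewrite addr0 mulr1 lerBlDr bD.
rewrite [X in _ - q * X]big1 ?mulr0 ?subr0 => [|v vJ]; last first.
  by case: eqP vJ nuJ => // -> ->.
have [/eqP|j0] := posnP #|J|.
  by rewrite cards_eq0 => /eqP->; rewrite big_set0 cards0 !mul0r.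
have sK : u |: J \subset A by rewrite subUset sub1set uA.
have := bD _ sK; rewrite big_setU1 //= cardsU1 nuJ add1n.
have avg : \sum_(v in J) D v <= #|J|%:R * D u.
  rewrite mulr_natl -sumr_const; apply: ler_sum => v vJ.
  by rewrite Du // (subsetP sJA).
have := ln_step j0; move: avg.
set s := \sum_(v in J) _; set L := ln #|V|%:R.
have : 0 < #|J|%:R :> R by rewrite ltr0n.
rewrite -natr1; set j : R := #|J|%:R => jp.
have j1 : 0 < j + 1 by rewrite addr_gt0.
set l := ln j; set l' := ln (j + 1) => avg lj sD.
rewrite -(ler_pM2l j1).
apply: (@le_trans _ _ (j * (D u + s))); first by nra.
apply: (@le_trans _ _ (j * ((j + 1) * q * (L - l') + q))).
  by rewrite ler_wpM2l // ltW.
have -> : j * ((j + 1) * q * (L - l') + q) =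
    (j + 1) * (j * q * (L - (l' - (j + 1)^-1))).
  by field; rewrite gt_eqF.
rewrite ler_wpM2l ?(ltW j1) // ler_wpM2l ?(mulr_ge0 (ltW jp)) //.
by rewrite lerD2l lerN2.
Qed.

End Danger.

(** * Derandomised coin tossing *)

Section Simulation.
Variables (R : realType) (V : finType) (G : sgraph V) (Q : sgraph V -> Prop).
Variables (eps p : R).
Hypothesis p01 : 0 < p < 1.
Implicit Types (X S Y B : {set {set V}}) (e : {set V}) (v : V).

Local Notation mean v := (p * (degree G v)%:R).

(* The constants are chosen so that once every edge is exposed, penalties   *)
(* below 1 bound the degree of v in S by 8/5 of its mean from above and by  *)
(* 3/5 of it from below, and the number of failures at v by 11/20 eps times *)
(* the mean provided that at most 162/1000 eps deg(v) edges at v lie in Y.  *)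
Definition penalty X S Y v : R :=
  tail p (2 / 3) 1 (- (1 / 15 * mean v)) S X v +
  tail p (- (4 / 5)) (- (1 / 2)) (- (1 / 50 * mean v)) S X v +
  tail p (2 / 3) 1 ((162 / 1000 - 11 / 30) * (eps * mean v)) (S :&: Y) Y v.

(** [X] is the set of exposed edges, [S] the set of those whose coin succeeded, and [Y] the set of
    those that Breaker owned when their coin was tossed. *)
Definition gain X S Y : R := cond_prob p G Q X S - \sum_v penalty X S Y v.

(** This is the condition of [tail_expose] for [lam = 2/3], [mu = 1]; it holds because (15/14)^10 is
    just below 2. *)
Lemma expR_2_3 : expR (2 / 3) <= 1 + 1 :> R.
Proof.
have h : expR (1 / 15) <= 15 / 14 :> R.
  have := expR_ge1Dx (- (1 / 15) : R).
  rewrite expRN => h; rewrite -lef_pV2 ?posrE ?expR_gt0 //; lra.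
have -> : 2 / 3 = 1 / 15 * 10%:R :> R by lra.
rewrite expRM_natr; apply: (@le_trans _ _ ((15 / 14) ^+ 10)).
  by rewrite lerXn2r ?nnegrE ?expR_ge0 //; lra.
by lra.
Qed.

Lemma expR_N4_5 : expR (- (4 / 5)) <= 1 - 1 / 2 :> R.
Proof.
have h : 6 / 5 <= expR (1 / 5) :> R.
  by apply: le_trans (expR_ge1Dx _); lra.
have -> : 4 / 5 = 1 / 5 * 4%:R :> R by lra.
have -> : 1 - 1 / 2 = 2^-1 :> R by lra.
rewrite expRN expRM_natr lef_pV2 ?posrE ?exprn_gt0 ?expR_gt0 //.
apply: (@le_trans _ _ ((6 / 5) ^+ 4)); first by lra.
by rewrite lerXn2r ?nnegrE ?expR_ge0 //; lra.
Qed.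

Lemma penalty_expose X S Y Y' B e v :
  e \notin X -> S \subset X -> Y \subset X ->
  Y' = Y :|: [set e] :&: B ->
  p * penalty (e |: X) (e |: S) Y' v + (1 - p) * penalty (e |: X) S Y' v
    <= penalty X S Y v.
Proof.
move=> eX sSX sYX defY'; have /andP[p0 p1] := p01.
have eS : e \notin S by apply: contra eX; apply: (subsetP sSX).
have eY : e \notin Y by apply: contra eX; apply: (subsetP sYX).
have t1 := tail_expose p01 (- (1 / 15 * mean v)) v expR_2_3 eX sSX.
have t2 := tail_expose p01 (- (1 / 50 * mean v)) v expR_N4_5 eX sSX.
set c := (162 / 1000 - 11 / 30) * (eps * mean v).
have t3 : p * tail p (2 / 3) 1 c ((e |: S) :&: Y') Y' v +
    (1 - p) * tail p (2 / 3) 1 c (S :&: Y') Y' v <=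
    tail p (2 / 3) 1 c (S :&: Y) Y v.
  (* The third tail sees only coins of edges in [Y]: it is constant unless [e] enters [Y]. *)
  have [eB|nB] := boolP (e \in B); last first.
    have -> : Y' = Y.
      apply/setP => f; rewrite defY' !inE; case: eqP => [->|_] /=.
        by rewrite (negPf nB) orbF.
      by rewrite orbF.
    have -> : (e |: S) :&: Y = S :&: Y.
      apply/setP => f; rewrite !inE; case: eqP => [->|_] //=.
      by rewrite (negPf eY) andbF.
    by rewrite -mulrDl addrC subrK mul1r.
  have -> : Y' = e |: Y.
    apply/setP => f; rewrite defY' !inE; case: eqP => [->|_] /=.
      by rewrite eB orbT.
    by rewrite orbF.
  have -> : (e |: S) :&: (e |: Y) = e |: (S :&: Y).
    by apply/setP => f; rewrite !inE; case: eqP.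
  have -> : S :&: (e |: Y) = S :&: Y.
    apply/setP => f; rewrite !inE; case: eqP => [->|_] //=.
    by rewrite (negPf eS).
  by apply: tail_expose => //; [exact: expR_2_3 | exact: subsetIr].
rewrite /penalty -/c; lra.
Qed.

(* One coin tossed by the method of conditional expectations. *)
Lemma gain_expose X S Y B e :
  e \in edges G :\: X -> S \subset X -> Y \subset X -> 0 < gain X S Y ->
  0 < gain (e |: X) (e |: S) (Y :|: [set e] :&: B) \/
  0 < gain (e |: X) S (Y :|: [set e] :&: B).
Proof.
move=> eGX sSX sYX g0; have /andP[p0 p1] := p01.
have eX : e \notin X by move: eGX; rewrite inE => /andP[].
set Y' := Y :|: _.
have : gain X S Y <= p * gain (e |: X) (e |: S) Y' + (1 - p) * gain (e |: X) S Y'.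
  rewrite /gain (cond_prob_expose _ _ eGX sSX).
  have : \sum_v (p * penalty (e |: X) (e |: S) Y' v +
      (1 - p) * penalty (e |: X) S Y' v) <= \sum_v penalty X S Y v.
    by apply: ler_sum => v _; exact: penalty_expose.
  rewrite big_split /= -!mulr_sumr; lra.
case: (ltP 0 (gain (e |: X) (e |: S) Y')) => [|n1]; first by left.
case: (ltP 0 (gain (e |: X) S Y')) => [|n2]; first by right.
by move=> h; exfalso; nra.
Qed.

Definition active X : {set V} :=
  [set v | [exists e in edges G :\: X, v \in e]]%SET.

Lemma activeP X v :
  reflect (exists2 e, e \in edges G :\: X & v \in e) (v \in active X).
Proof. by rewrite inE; apply: exists_inP. Qed.

Lemma activeS X X' : X \subset X' -> active X' \subset active X.
Proof.
move=> sXX; apply/subsetP => v /activeP[e eX ve]; apply/activeP; exists e => //.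
exact: subsetP (setDS _ sXX) _ eX.
Qed.

Lemma active0 X : X \subset edges G -> active X = set0 -> X = edges G.
Proof.
move=> sXE a0; apply/eqP; rewrite eqEsubset sXE; apply/subsetP => e eE.
apply: contraT => eX.
have /card_gt0P[v ve] : (0 < #|e|)%N by rewrite (sgraph_card_edge eE).
have : v \in active X by apply/activeP; exists e; rewrite // inE eX.
by rewrite a0 inE.
Qed.

(** The coin tosses of one turn of Maker, by induction on the number of unexposed edges. They stop
    at the first success, so there is at most one edge to claim; Breaker's edges [B] stay fixed
    meanwhile. *)
Lemma expose_vertex v B X S Y :
  X \subset edges G -> S \subset X -> Y \subset X -> 0 < gain X S Y ->
  exists X' S' Y',
    [/\ X \subset X', X' \subset edges G, Y' = Y :|: (X' :\: X) :&: B,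
        0 < gain X' S' Y' &
        (S' = S /\ v \notin active X') \/
        (exists e, [/\ e \in X' :\: X, v \in e & S' = e |: S])].
Proof.
move: {2}#|_| (leqnn #|edges G :\: X|) => n; elim: n X S Y => [|n IH] X S Y.
  rewrite leqn0 cards_eq0 => /eqP EX sXE sSX sYX g0.
  exists X, S, Y; split => //; first by rewrite setDv set0I setU0.
  by left; split=> //; apply/activeP => -[e]; rewrite EX inE.
move=> leE sXE sSX sYX g0.
have [/activeP[e eX ve]|na] := boolP (v \in active X); last first.
  exists X, S, Y; split => //; first by rewrite setDv set0I setU0.
  by left.
have [eE enX] : e \in edges G /\ e \notin X.
  by move: eX; rewrite inE => /andP[].
have sX1 : e |: X \subset edges G by rewrite subUset sub1set eE.
have D1 : (e |: X) :\: X = [set e].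
  apply/setP => f; rewrite !inE; case: eqP => [->|_] /=; first by rewrite enX.
  by rewrite andNb.
have [g1|g1] := gain_expose B eX sSX sYX g0.
  exists (e |: X), (e |: S), (Y :|: [set e] :&: B); split => //.
  - exact: subsetUr.
  - by rewrite D1.
  - by right; exists e; rewrite D1 inE.
have sS1 : S \subset e |: X by apply: subset_trans sSX (subsetUr _ _).
have sY1 : Y :|: [set e] :&: B \subset e |: X.
  rewrite subUset (subset_trans sYX (subsetUr _ _)) /=.
  exact: subset_trans (subsetIl _ _) (subsetUl _ _).
have le1 : (#|edges G :\: (e |: X)| <= n)%N.
  rewrite -ltnS; apply: leq_trans leE.
  apply/proper_card/properP; split; first exact/setDS/subsetUr.
  by exists e; rewrite // !inE eqxx.
have [X' [S' [Y' [sX' sE' -> g' alt]]]] := IH _ _ _ le1 sX1 sS1 sY1 g1.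
have sXX' : X \subset X' by apply: subset_trans sX'; apply: subsetUr.
have eX' : e \in X' by apply: (subsetP sX'); rewrite setU11.
exists X', S', (Y :|: [set e] :&: B :|: (X' :\: (e |: X)) :&: B); split => //.
- rewrite -setUA -setIUl; congr (_ :|: _ :&: _).
  apply/setP => f; rewrite !inE; case: eqP => [->|_] //=.
  by rewrite eX' enX.
- case: alt => [|[f [fX vf ->]]]; [by left | right; exists f; split => //].
  by move: fX; rewrite !inE negb_or -andbA => /and3P[_ -> ->].
Qed.

End Simulation.

(** * Maker's strategy and the invariant that it preserves *)

Section Game.
Variables (R : realType) (V : finType) (G : sgraph V) (P : graph_prop).
Variables (eps p : R) (b : nat) (mf : bool).
Hypothesis eps0 : 0 < eps <= 1 / 100.
Hypothesis p01 : 0 < p < 1.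

(* Each of the b edges claimed in a turn of Breaker raises two degrees. *)
Local Notation q := ((2 * b)%:R : R).
Local Notation Q :=
  (fun H : sgraph V => (eps%:E <= local_resilience R P H)%E).
Local Notation breaker_claimed := (maker_claimed (~~ mf)).

(** [t v] counts Maker's turns spent on [v]. The bound [good_t] is dropped once [v] is inactive, as
    the last turn on [v] may bring no success. The slack in [good_danger] is added by a turn of
    Breaker and removed by one of Maker. [good_size] records that each turn of Maker exposes an edge
    while any is left. *)
Record good_state (h : history {set V}) (X S Y : {set {set V}}) (t : V -> nat)
    : Prop := GoodState {
  good_XE : X \subset edges G;
  good_SX : S \subset X;
  good_YX : Y \subset X;
  good_YB : Y \subset breaker_claimed h;
  good_SM : S :\: Y \subset maker_claimed mf h;
  good_gain : 0 < gain G Q eps p X S Y;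
  good_t : forall v, v \in active G X -> (t v <= degree_in S v)%N;
  good_danger : danger_bound (active G X)
    (fun v => (degree_in (breaker_claimed h) v)%:R - q * (t v)%:R) q
    (if maker_turn mf (size h) then q else 0);
  good_degY : forall v,
    (degree_in Y v)%:R <= q * (ln #|V|%:R + 1 + (degree_in S v)%:R);
  good_size : X = edges G \/
    (size h <= 2 * #|X| + maker_turn mf (size h))%N }.

Definition good_position h : Prop := exists X S Y t, good_state h X S Y t.

Hypothesis V0 : (0 < #|V|)%N.
Hypothesis gain0 : 0 < gain G Q eps p set0 set0 set0.

Let lnV0 : 0 <= ln #|V|%:R :> R.
Proof. by rewrite ln_ge0 // ler1n. Qed.

Lemma good_position_nil : good_position [::].
Proof.
have claimed0 m : maker_claimed m [::] = set0 :> {set {set V}}.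
  by rewrite /maker_claimed big_ord0.
exists set0, set0, set0, (fun=> 0%N); split; rewrite ?claimed0 ?sub0set ?subxx //.
- by rewrite setD0 sub0set.
- under eq_fun do rewrite degree_in0 mulr0 subr0.
  by apply: danger_bound_const0; [|case: ifP].
- move=> v; rewrite degree_in0 mulr_ge0 // !addr_ge0 //.
- by right.
Qed.

(** The danger bound at the singleton of [v], where the subtracted logarithm is 0; the slack
    accounts for the summand 1. *)
Lemma good_degB h X S Y t v : good_state h X S Y t -> v \in active G X ->
  (degree_in (breaker_claimed h) v)%:R <=
  q * (ln #|V|%:R + 1 + (degree_in S v)%:R).
Proof.
move=> gs va; have := good_danger gs (J := [set v]).
rewrite sub1set va big_set1 cards1 ln1 subr0 mul1r => /(_ isT) D.
have tS : (t v)%:R <= (degree_in S v)%:R :> R by rewrite ler_nat (good_t gs).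
have q0 : 0 <= q by [].
have slack : (if maker_turn mf (size h) then q else 0) <= q by case: ifP.
have : q * (t v)%:R <= q * (degree_in S v)%:R by rewrite ler_wpM2l.
move: D slack; set s := (if _ then _ else _); set L := ln _; lra.
Qed.

Lemma good_position_breaker h A :
  good_position h -> ~~ maker_turn mf (size h) ->
  legal_move (edges G) 1 b mf h A -> good_position (rcons h A).
Proof.
move=> [X [S [Y [t gs]]]] nm /andP[sA cA]; exists X, S, Y, t.
have nm' : maker_turn mf (size (rcons h A)).
  by move: nm; rewrite size_rcons /maker_turn /= addNb.
case: gs => XE SX YX YB SM g0 tS D dY sz.
have eqM : maker_claimed mf (rcons h A) = maker_claimed mf h.
  by rewrite claimed_rcons (negPf nm).
have eqB : breaker_claimed (rcons h A) = breaker_claimed h :|: A.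
  by rewrite claimed_rcons maker_turnN nm.
split; rewrite ?eqM ?eqB ?nm' //.
- exact: subset_trans YB (subsetUl _ _).
- have sAE : A \subset edges G by apply: subset_trans sA (subsetDl _ _).
  rewrite -[X in danger_bound _ _ _ X]add0r; move: D; rewrite (negPf nm).
  apply: danger_boundD => [v|].
    by rewrite lerD2r ler_nat degree_inS // subsetUl.
  apply: (@le_trans _ _ (\sum_v (degree_in A v)%:R)).
    apply: ler_sum => v _.
    rewrite opprB addrA subrK lerBlDl -natrD ler_nat.
    exact: degree_inU.
  (* Handshake: at most [b] edges of two ends each add at most [q] in total. *)
  rewrite -natr_sum sum_degree_in ler_nat.
  rewrite (eq_bigr (fun=> 2%N)) => [|e eA]; last first.
    exact: sgraph_card_edge (subsetP sAE _ eA).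
  rewrite sum_nat_const mulnC leq_mul2l /=.
  by move: cA; rewrite (negPf nm) => /eqP->; apply: geq_minl.
- case: sz => [->|sz]; [by left | right].
  by move: sz; rewrite size_rcons (negPf nm) addn0 addn1 ltnS.
Qed.

Lemma good_position_maker h :
  good_position h -> maker_turn mf (size h) ->
  exists2 A, legal_move (edges G) 1 b mf h A & good_position (rcons h A).
Proof.
move=> [X [S [Y [t gs]]]] mt.
have nm' A : maker_turn mf (size (rcons h A)) = false.
  by move: mt; rewrite size_rcons /maker_turn /= addNb => ->.
have eqM A : maker_claimed mf (rcons h A) = maker_claimed mf h :|: A.
  by rewrite claimed_rcons mt.
have eqB A : breaker_claimed (rcons h A) = breaker_claimed h.
  by rewrite claimed_rcons maker_turnN mt.
have degB := good_degB gs.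
case: gs => XE SX YX YB SM g0 tS D dY sz.
have [a0|[v0 v0a]] := set_0Vmem (active G X).
  have [A lA] := exists_legal_move (edges G) 1 b mf h.
  exists A => //; exists X, S, Y, t; split; rewrite ?eqM ?eqB ?nm' //.
  - exact: subset_trans SM (subsetUl _ _).
  - move=> J; rewrite a0 subset0 => /eqP->.
    by rewrite big_set0 cards0 !mul0r addr0.
  - by left; apply: active0.
pose dang v : R := (degree_in (breaker_claimed h) v)%:R - q * (t v)%:R.
have [u ua umax] : exists2 u, u \in active G X &
    {in active G X, forall v, dang v <= dang u}.
  by case: (arg_maxP dang v0a) => u ua umax; exists u.
have [X' [S' [Y' [sXX' XE' defY' g' alt]]]] :=
  expose_vertex p01 u (breaker_claimed h) XE SX YX g0.
have sSS' : S \subset S'.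
  by case: alt => [[-> _]|[e [_ _ ->]]]; rewrite ?subsetUr.
have sSX' : S' \subset X'.
  have := subset_trans SX sXX'; case: alt => [[-> _]|[e [eX _ ->]]] // sS.
  by rewrite subUset sub1set sS andbT; move: eX; rewrite inE => /andP[].
have sYX' : Y' \subset X'.
  rewrite defY' subUset (subset_trans YX sXX') /=.
  exact: subset_trans (subsetIl _ _) (subsetDl _ _).
have sYB' : Y' \subset breaker_claimed h.
  by rewrite defY' subUset YB subsetIr.
(* Even a turn without success exposes an edge, since [u] was active and no longer is. *)
have ltX : (#|X| < #|X'|)%N.
  apply: proper_card; rewrite properEneq sXX' andbT.
  case: alt => [[_ ua']|[e [eX _ _]]].
    by apply: contra ua' => /eqP <-.
  by apply: contraTneq eX => ->; rewrite setDv inE.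
have [A lA SMA] : exists2 A, legal_move (edges G) 1 b mf h A &
    S' :\: Y' \subset maker_claimed mf h :|: A.
  have sYY' : Y \subset Y' by rewrite defY' subsetUl.
  have SM' A : S :\: Y' \subset maker_claimed mf h :|: A.
    by apply: subset_trans (subset_trans SM (subsetUl _ _)); apply: setDS.
  have [A lA] := exists_legal_move (edges G) 1 b mf h.
  case: alt => [[-> _]|[e [eX _ ->]]]; first by exists A.
  have [eX' enX] : e \in X' /\ e \notin X.
    by move: eX; rewrite inE => /andP[].
  have [eu|neu] := boolP (e \in unclaimed (edges G) h).
    exists [set e].
      rewrite /legal_move sub1set eu mt cards1 /=.
      by rewrite eq_sym; apply/eqP/minn_idPl/card_gt0P; exists e.
    rewrite setDUl subUset SM' andbT.
    exact: subset_trans (subsetDl _ _) (subsetUr _ _).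
  (* A successful edge that is not free is already Maker's, or is Breaker's and so lies in [Y']; any
     legal move serves. *)
  exists A => //; rewrite setDUl subUset SM' andbT.
  apply/subsetP => f; rewrite !inE => /andP[fY' /eqP ef]; subst f.
  move: neu; rewrite inE (subsetP XE' _ eX') andbT negbK (bigcup_claimed mf).
  case/setUP => [->|eB] //; case/negP: fY'.
  by rewrite defY' !inE eX' enX eB orbT.
exists A => //; exists X', S', Y', (fun v => t v + (v == u))%N.
split; rewrite ?eqM ?eqB ?nm' //.
- move=> v va; have := tS v (subsetP (activeS G sXX') _ va).
  have := degree_inS v sSS'.
  case: eqP => [vu|_]; last by rewrite addn0 => le1 le2; apply: leq_trans le1.
  (* If [u] is still active, the turn ended in a success at [u], so both sides grow by one. *)
  subst v; case: alt => [[_ /negP] //|[e [eX ue ->]]] _ tu.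
  rewrite degree_inU1 ?ue ?add1n ?addn1 ?ltnS //.
  by move: eX; rewrite inE => /andP[enX _]; apply: contra enX; apply: (subsetP SX).
- have -> : (fun v => (degree_in (breaker_claimed h) v)%:R -
      q * (t v + (v == u))%N%:R) = (fun v => dang v - q * (v == u)%:R).
    by apply/funext => v; rewrite /dang natrD mulrDr opprD addrA.
  apply: (danger_bound_greedy _ ua umax (activeS G sXX')) => //.
  by move: D; rewrite mt.
- move=> v.
  have le' : q * (ln #|V|%:R + 1 + (degree_in S v)%:R) <=
      q * (ln #|V|%:R + 1 + (degree_in S' v)%:R).
    by rewrite ler_wpM2l // lerD2l ler_nat degree_inS.
  (* At an active [v], Breaker's degree bounds that of [Y']; at an inactive one no further edge is
     exposed. *)
  apply: le_trans le'; have [va|nva] := boolP (v \in active G X).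
    by apply: le_trans (degB v va); rewrite ler_nat degree_inS.
  apply: le_trans (dY v); rewrite ler_nat.
  apply/subset_leq_card/subsetP => e; rewrite defY' !inE.
  case/andP => /orP[->|/andP[/andP[enX eX'] _]] ve; first by rewrite ve.
  case/negP: nva; apply/activeP; exists e => //.
  by rewrite inE enX (subsetP XE').
- case: sz => [XEq|sz]; right.
    have := subset_leq_card XE'; by rewrite -XEq leqNgt ltX.
  rewrite size_rcons addn0; apply: leq_ltn_trans sz _; rewrite mt addn1.
  by apply: leq_trans (leq_mul (leqnn 2) ltX); rewrite mulnS.
Qed.

Hypothesis few_breaker : forall v,
  q * (ln #|V|%:R + 1 + 8 / 5 * (p * (degree G v)%:R)) <=
  162 / 1000 * eps * (degree G v)%:R.

Lemma good_position_wins h :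
  good_position h -> (2 * #|edges G| + 2 <= size h)%N ->
  exists2 W, winning_sets P G W & W \subset maker_claimed mf h.
Proof.
move=> [X [S [Y [t [XE SX YX YB SM g0 _ _ dY sz]]]]] szh.
(* After [2 * #|edges G| + 2] turns the second alternative of [good_size] fails, by one turn at
   least. *)
have {sz} XEq : X = edges G.
  case: sz => // sz; have := leq_trans szh sz; rewrite leqNgt.
  rewrite (leq_ltn_trans (leq_add (leq_mul (leqnn 2) (subset_leq_card XE))
    (leq_b1 _))) // ltn_add2l //.
subst X; move: g0; rewrite /gain subr_gt0 => pen_lt.
have pen_ge0 v : 0 <= penalty G eps p (edges G) S Y v.
  by rewrite /penalty /tail !addr_ge0 ?expR_ge0.
have [c1 cQ] := cond_prob_full p G Q S.
have [H HS QH] : exists2 H, edges H = S & Q H.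
  by apply: cQ; apply: le_lt_trans pen_lt; apply: sumr_ge0.
have pen1 v : penalty G eps p (edges G) S Y v < 1.
  apply: lt_le_trans c1; apply: le_lt_trans pen_lt.
  by rewrite (bigD1 v) //= lerDl sumr_ge0.
have /andP[p0 p1] := p01; have /andP[e0 e1] := eps0.
have bounds v : 3 / 5 * (p * (degree G v)%:R) <= (degree_in S v)%:R /\
    (degree_in (S :&: Y) v)%:R <= 11 / 20 * eps * (p * (degree G v)%:R).
  have := pen1 v; rewrite /penalty /tail -/(degree G v).
  set d : R := (degree G v)%:R.
  set x1 := 2 / 3 * _ - _ + _; set x2 := _ * _ - _ + _.
  set x3 := 2 / 3 * _ - _ + _ => lt1.
  have lt0 x : expR x < 1 -> x < 0 by rewrite -expR0 ltr_expR.
  have X1 : x1 < 0.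
    by apply: lt0; have := expR_ge0 x2; have := expR_ge0 x3; lra.
  have X2 : x2 < 0.
    by apply: lt0; have := expR_ge0 x1; have := expR_ge0 x3; lra.
  have X3 : x3 < 0.
    by apply: lt0; have := expR_ge0 x1; have := expR_ge0 x2; lra.
  have S1 : (degree_in S v)%:R <= 8 / 5 * (p * d) by rewrite /x1 in X1; lra.
  split; first by rewrite /x2 in X2; lra.
  (* The upper bound [S1] is what turns [good_degY] into [few_breaker]. *)
  have Yd : (degree_in Y v)%:R <= 162 / 1000 * eps * d.
    apply: le_trans (few_breaker v); apply: le_trans (dY v) _.
    by rewrite ler_wpM2l // lerD2l.
  have : p * (degree_in Y v)%:R <= p * (162 / 1000 * eps * d).
    by rewrite ler_wpM2l // ltW.
  rewrite /x3 in X3; lra.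
have sHE : S :\: Y \subset edges G := subset_trans (subsetDl _ _) SX.
pose H' : sgraph V := SGraph (subset_edgesP sHE).
have [PH'|nPH'] := pselect (@P V H').
  have [W wW sW] := winning_sets_of_subgraph (G := G) (H := H') sHE PH'.
  by exists W => //; apply: subset_trans sW SM.
exfalso; move: QH; apply/negP; rewrite -ltNge.
(* Deleting [S :&: Y] from [S] costs a proportion of at most 11/20 [eps] over 3/5, that is 11/12
   [eps], at each vertex. *)
apply: (@le_lt_trans _ _ (11 / 12 * eps)%:E); last by rewrite lte_fin; lra.
apply: ereal_inf_lbound; exists (11 / 12 * eps) => //; split.
  by apply/andP; split; lra.
exists H'; split => //.
  by rewrite /subgraph /= HS subsetDl.
move=> v; rewrite /degree /= HS setDDr setDv set0U.
have [b1 b2] := bounds v.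
by have := ler_wpM2l (ltW e0) b1; lra.
Qed.

Lemma maker_wins :
  maker_has_winning_strategy (edges G) (winning_sets P G) 1 b mf.
Proof.
apply: (maker_wins_by_invariant (Inv := good_position)
  (K := (2 * #|edges G| + 2)%N)).
- exact: good_position_nil.
- exact: good_position_maker.
- exact: good_position_breaker.
- exact: good_position_wins.
Qed.

End Game.

(** * Numerical estimates for large [n] *)

Section Numerics.
Variables (R : realType) (V : finType) (G : sgraph V) (eps p : R).
Hypothesis eps01 : 0 < eps <= 1 / 100.
Hypothesis p01 : 0 < p < 1.
Hypothesis V7 : (7 <= #|V|)%N.
Hypothesis degG : 10 * ln (#|V|%:R : R) / (eps * p) <= (min_degree G)%:R.

Let n7 : 7 <= #|V|%:R :> R.
Proof. by rewrite ler_nat. Qed.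

Let ln_ge1 : 1 <= ln #|V|%:R :> R.
Proof.
rewrite -ler_expR lnK ?posrE; last by apply: lt_le_trans n7.
have h : expR 1 <= expR (2 / 3 + 2 / 3) :> R by rewrite ler_expR; lra.
apply: (le_trans h); rewrite expRD; have := expR_2_3 R.
have := expR_ge0 (2 / 3 : R); have := n7; nra.
Qed.

Let mean_ge v : 10 * ln #|V|%:R <= eps * (p * (degree G v)%:R).
Proof.
have /andP[e0 _] := eps01; have /andP[p0 _] := p01.
have : 10 * ln (#|V|%:R : R) / (eps * p) <= (degree G v)%:R.
  by apply: le_trans degG _; rewrite ler_nat min_degree_le.
by rewrite ler_pdivrMr ?mulr_gt0 // [leRHS]mulrC mulrA.
Qed.

Lemma few_breaker_edges v :
  (2 * Num.truncn (eps / (20 * p)))%:R *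
    (ln #|V|%:R + 1 + 8 / 5 * (p * (degree G v)%:R)) <=
  162 / 1000 * eps * (degree G v)%:R.
Proof.
have /andP[e0 e1] := eps01; have /andP[p0 _] := p01.
set b := Num.truncn _.
have b_le : b%:R * (20 * p) <= eps.
  rewrite -ler_pdivlMr ?mulr_gt0 // /b truncn_le.
  by rewrite divr_ge0 ?mulr_ge0 ?ltW.
have m := mean_ge v; have L1 := ln_ge1; rewrite natrM.
have b0 : 0 <= b%:R :> R by [].
have d0 : 0 <= (degree G v)%:R :> R by [].
move: b0 d0 b_le m L1; move: b%:R (degree G v)%:R (ln _) => B d L B0 d0 Bp m L1.
have pd0 : 0 <= p * d by rewrite mulr_ge0 // ltW.
have m' : eps * (p * d) <= 1 / 100 * (p * d) by rewrite ler_wpM2r.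
(* ln n + 1 <= 2 ln n <= [eps * (p * d) / 5] <= [p * d / 500], and 8/5 = 800/500. With [Bp] the
   total is 801/5000 [eps * d], just below 162/1000 [eps * d]. *)
apply: (@le_trans _ _ (2 * B * (801 / 500 * (p * d)))).
  by rewrite ler_wpM2l ?mulr_ge0 //; lra.
have : B * (20 * p) * d <= eps * d by rewrite ler_wpM2r.
have : 0 <= eps * d by rewrite mulr_ge0 // ltW.
lra.
Qed.

(** Each of the three exponents is at most -2 ln n, so the sum is at most 3/n. The third is the
    tight one: (11/30 - 162/1000) * 10 just exceeds 2, by the factor 10 in the degree condition. *)
Lemma sum_penalty0 :
  \sum_v penalty G eps p set0 set0 set0 v < 1 / 2.
Proof.
have /andP[e0 e1] := eps01; have /andP[p0 _] := p01.
have n0 : 0 < #|V|%:R :> R by apply: lt_le_trans n7.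
have pen v : penalty G eps p set0 set0 set0 v <= 3 * (#|V|%:R ^- 2).
  rewrite /penalty /tail set0I !degree_in0 !mulr0 subr0 !add0r.
  have exp_le c : c <= - (ln #|V|%:R * 2%:R) -> expR c <= #|V|%:R ^- 2 :> R.
    move=> hc; rewrite -[X in X ^- 2]lnK ?posrE // -expRM_natr -expRN.
    by rewrite ler_expR.
  have m := mean_ge v; have L1 := ln_ge1.
  have d0 : 0 <= p * (degree G v)%:R by rewrite mulr_ge0 // ltW.
  have m' : eps * (p * (degree G v)%:R) <= 1 / 100 * (p * (degree G v)%:R).
    by rewrite ler_wpM2r.
  rewrite (_ : 3 * _ = #|V|%:R ^- 2 + #|V|%:R ^- 2 + #|V|%:R ^- 2); last by ring.
  by rewrite !lerD // exp_le //; lra.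
apply: (@le_lt_trans _ _ (\sum_(v : V) 3 * (#|V|%:R ^- 2))).
  by apply: ler_sum => v _.
rewrite sumr_const -[X in X < _]mulr_natr -mulrA.
have -> : #|V|%:R ^- 2 * #|V|%:R = #|V|%:R^-1 :> R.
  by field; rewrite gt_eqF.
by rewrite ltr_pdivrMr //; have := n7; lra.
Qed.

End Numerics.

Theorem theorem1p5 (R : realType) (eps : R) (heps : 0 < eps <= 1 / 100)
    (p : nat -> R) (hp : forall n, 0 < p n < 1)
    (V : nat -> finType) (hV : forall n, #|V n| = n)
    (G : forall n, sgraph (V n))
    (P : graph_prop) (hmono : monotone_increasing_property P)
    (hres : resilient P G p eps) :
  exists N : nat, forall n : nat, (N <= n)%N ->
    10 * ln (n%:R : R) / (eps * p n) <= (min_degree (G n))%:R ->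
    forall maker_first : bool,
      maker_has_winning_strategy (edges (G n)) (winning_sets P (G n))
        1 (Num.truncn (eps / (20 * p n))) maker_first.
Proof.
(* For large [n] resilience has probability above 1/2 while the penalties sum to less than 1/2, so
   the initial gain is positive; 3/n < 1/2 requires [n >= 7]. *)
have half1 : 1 / 2 < 1 :> R by lra.
have [N _ probN] := cvgr_gt _ hres _ half1.
exists (maxn N 7) => n; rewrite geq_max => /andP[Nn n7] deg mf.
have degG : 10 * ln (#|V n|%:R : R) / (eps * p n) <= (min_degree (G n))%:R.
  by rewrite hV.
have V7 : (7 <= #|V n|)%N by rewrite hV.
apply: (maker_wins mf heps (hp n)).
- exact: ltn_trans V7.
- rewrite /gain cond_prob0 subr_gt0.
  exact: lt_trans (sum_penalty0 heps (hp n) V7 degG) (probN n Nn).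
- exact: few_breaker_edges (hp n) V7 degG.
Qed.
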